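(* Let $0<q<1$, let $r,s\geq 0$ be integers, let $a,b,c,d\in\mathbb{C}$, $\mathbf{e}=(e_1,\dots,e_r)\in\mathbb{C}^r$ and $\mathbf{f}=(f_1,\dots,f_s)\in\mathbb{C}^s$, with the parameters such that all the basic hypergeometric series below are defined. Then, as an identity of power series in $z$, \begin{multline*} (a-b)(a-c)(bc-d)(1-d)\, {}_{r+4}\phi_{s+3}\!\left[\begin{matrix} a^{-1}bc,\ bcq^{-2},\ c,\ dq^{-1},\ \mathbf{e}\\ aq^{-1},\ bq^{-1},\ bcd^{-1},\ \mathbf{f}\end{matrix};q,z\right] {}_{r+4}\phi_{s+3}\!\left[\begin{matrix} a^{-1}bc,\ bc,\ c,\ dq,\ \mathbf{e}q\\ aq,\ bq,\ bcd^{-1},\ \mathbf{f}q\end{matrix};q,q^{s-r}z\right]\\ =(a-d)(1-b)(1-c)(bc-ad)\, {}_{r+4}\phi_{s+3}\!\left[\begin{matrix} a^{-1}bc,\ bcq^{-2},\ cq^{-1},\ d,\ \mathbf{e}\\ aq^{-1},\ b,\ bcd^{-1}q^{-1},\ \mathbf{f}\end{matrix};q,z\right] {}_{r+4}\phi_{s+3}\!\left[\begin{matrix} a^{-1}bc,\ bc,\ cq,\ d,\ \mathbf{e}q\\ aq,\ b,\ bcd^{-1}q,\ \mathbf{f}q\end{matrix};q,q^{s-r}z\right]\\ -(1-a)(b-d)(c-d)(a-bc)\, {}_{r+4}\phi_{s+3}\!\left[\begin{matrix} a^{-1}bcq^{-1},\ bcq^{-2},\ c,\ d,\ \mathbf{e}\\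 a,\ bq^{-1},\ bcd^{-1}q^{-1},\ \mathbf{f}\end{matrix};q,z\right] {}_{r+4}\phi_{s+3}\!\left[\begin{matrix} a^{-1}bcq,\ bc,\ c,\ d,\ \mathbf{e}q\\ a,\ bq,\ bcd^{-1}q,\ \mathbf{f}q\end{matrix};q,q^{s-r}z\right]. \end{multline*}
   Context: For $n\in\mathbb{Z}$: $(a;q)_\infty=\prod_{k\ge0}(1-aq^k)$, $(a;q)_n=(a;q)_\infty/(aq^n;q)_\infty$, and $(a_1,\dots,a_m;q)_n=\prod_i(a_i;q)_n$. The basic hypergeometric series is ${}_{R}\phi_{S}\left[\begin{matrix}\alpha_1,\dots,\alpha_R\\ \beta_1,\dots,\beta_S\end{matrix};q,z\right]=\sum_{n\ge0}\frac{(\alpha_1,\dots,\alpha_R;q)_n}{(q,\beta_1,\dots,\beta_S;q)_n}\left((-1)^nq^{\binom n2}\right)^{1+S-R}z^n.$ In the parameter lists, $\mathbf{e}$ stands for the entries $e_1,\dots,e_r$, $\mathbf{e}q$ for $e_1q,\dots,e_rq$, and similarly $\mathbf{f}$, $\mathbf{f}q$. *)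

(* Defs.v *)
From HB Require Import structures.
From mathcomp Require Import all_boot all_order all_algebra.
From mathcomp Require Import complex.
From mathcomp Require Import boolp classical_sets filter reals topology.
From mathcomp Require Import normedtype sequences.

Set Implicit Arguments.
Unset Strict Implicit.
Unset Printing Implicit Defensive.

Import Order.TTheory GRing.Theory Num.Theory.
Import numFieldNormedType.Exports.

Local Open Scope ring_scope.

Section QSeries.
Variable K : fieldType.
Implicit Types (a q w : K) (al be : seq K) (f g : nat -> K).

(* (a;q)_n for n >= 0, the only indices occurring in a basic hypergeometric
   series. The quotient (a;q)_oo / (a q^n;q)_oo telescopes to this product
   (see qpoch_cvg); unlike the literal quotient, the product also covers the
   case a q^n = q^(-m), where both infinite products vanish. *)
Definition qpoch a q (n : nat) : K := \prod_(k < n) (1 - a * q ^+ k).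

Definition qpochs al q (n : nat) : K := \prod_(a <- al) qpoch a q n.

(* All the denominators (q, be_1, ..., be_S; q)_n are nonzero. *)
Definition bhs_defined be q : Prop := forall n, qpochs (q :: be) q n != 0.

(* A formal power series in z over K is given by its coefficients nat -> K.
   [bhs al be q w] is phi[al; be; q, w z] as such a series; since it need not
   converge (when size al > (size be).+1), z is kept formal. The exponent
   1 + S - R is an integer and may be negative. *)
Definition bhs al be q w : nat -> K := fun n =>
  qpochs al q n / qpochs (q :: be) q n
  * ((-1) ^+ n * q ^+ 'C(n, 2)) ^ (1 + (size be)%:Z - (size al)%:Z)
  * w ^+ n.

Definition fps_mul f g : nat -> K := fun n => \sum_(i < n.+1) f i * g (n - i)%N.

End QSeries.

(* (a;q)_oo = (a;q)_n (a q^n;q)_oo. *)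
Lemma qpoch_cvg (K : numFieldType) (a q l : K) (n : nat) :
  (qpoch (a * q ^+ n) q @ \oo --> l)%classic ->
  (qpoch a q @ \oo --> qpoch a q n * l)%classic.
Proof.
move=> cvl; rewrite -(cvg_shiftn n).
have -> : (fun N => qpoch a q (N + n)%N) =
          (fun N => qpoch a q n * qpoch (a * q ^+ n) q N).
  apply/funext => N; rewrite /qpoch addnC big_split_ord /=; congr (_ * _).
  by apply: eq_bigr => k _; rewrite exprD mulrA.
exact: cvgMl_tmp.
Qed.

(* Main.v *)
Require Import Defs.
From HB Require Import structures.
From mathcomp Require Import all_boot all_order all_algebra.
From mathcomp Require Import complex reals ring.

Set Implicit Arguments.
Unset Strict Implicit.
Unset Printing Implicit Defensive.

Import Order.TTheory GRing.Theory Num.Theory.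
Local Open Scope ring_scope.

(* In the coefficient of z^n the parameters e and f and the powers of q
   contribute the same factor to the summands of index i of the three products,
   and for i >= 1 that factor is invariant under i <-> n+1-i because
   (x)_i (xq)_(n-i) = (1-x) (xq)_(i-1) (xq)_(n-i). The combination of the
   remaining factors vanishes for i = 0; for i >= 1 it is, by a polynomial
   identity in a, b, c, d, q and x = q^(i-1), y = q^(n-i), a symmetric expression
   times x - y. Hence the sum cancels in pairs. *)

(** * Cancellation in antisymmetric convolution sums *)

Section Convolution.
Variable K : numFieldType.

(** Reversing the order of summation gives S = -S, and 2 is nonzero in characteristic 0. *)
Lemma sum_antisym (G : nat -> nat -> K) (n : nat) :
  (forall i j, G i j = - G j i) -> \sum_(i < n.+1) G i (n - i)%N = 0.
Proof.
move=> antiG; set S := LHS.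
have SN : S = - S.
  rewrite {1}/S (reindex_inj rev_ord_inj) /= -sumrN.
  by apply: eq_bigr => i _; rewrite subSS subKn 1?antiG // -ltnS.
have /eqP : S *+ 2 = 0 by rewrite mulr2n {1}SN addNr.
by rewrite mulrn_eq0 => /eqP.
Qed.

End Convolution.

(** * Shift rules for (p;q)_n and the contribution of [e] and [f] *)

Section QPochhammer.
Variables (K : fieldType) (q : K).
Hypothesis q_neq0 : q != 0.
Implicit Types (p w : K) (al be e f : seq K) (i j n : nat).

Lemma qpoch0 p : qpoch p q 0 = 1.
Proof. exact: big_ord0. Qed.

Lemma qpochSr p n : qpoch p q n.+1 = qpoch p q n * (1 - p * q ^+ n).
Proof. exact: big_ord_recr. Qed.

Lemma qpochS p n : qpoch p q n.+1 = (1 - p) * qpoch (p * q) q n.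
Proof.
rewrite /qpoch big_ord_recl expr0 mulr1; congr (_ * _).
by apply: eq_bigr => i _; rewrite exprS mulrA.
Qed.

Lemma qpochS_div p n : qpoch (p / q) q n.+1 = (1 - p / q) * qpoch p q n.
Proof. by rewrite qpochS divfK. Qed.

Lemma qpoch_shift p n :
  (1 - p) * qpoch (p * q) q n = qpoch p q n * (1 - p * q ^+ n).
Proof. by rewrite -qpochS qpochSr. Qed.

Lemma qpochs_cons p al n : qpochs (p :: al) q n = qpoch p q n * qpochs al q n.
Proof. exact: big_cons. Qed.

Lemma qpochs_nil n : qpochs [::] q n = 1.
Proof. exact: big_nil. Qed.

Lemma qpochs_cat al be n :
  qpochs (al ++ be) q n = qpochs al q n * qpochs be q n.
Proof. exact: big_cat. Qed.

Lemma qpochsS al n : qpochs al q n.+1 =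
  \prod_(p <- al) (1 - p) * qpochs [seq p * q | p <- al] q n.
Proof.
by rewrite /qpochs big_map -big_split; apply: eq_bigr => p _; rewrite qpochS.
Qed.

Definition qpoch_nz p : Prop := forall n, qpoch p q n != 0.

Lemma bhs_defined_nz be p : bhs_defined be q -> p \in q :: be -> qpoch_nz p.
Proof.
move=> be_neq0 p_be n; move: (be_neq0 n).
by rewrite /qpochs prodf_seq_neq0 => /allP/(_ p p_be).
Qed.

Definition bhs_tail e f w n : K :=
  qpochs e q n / qpochs f q n
  * ((-1) ^+ n * q ^+ 'C(n, 2)) ^ ((size f)%:Z - (size e)%:Z) * w ^+ n.

(** As [al] is one entry longer than [be], the exponent 1 + S - R depends only on the lengths of [e]
    and [f]. *)
Lemma bhs_cat al be e f w n : size al = (size be).+1 ->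
  bhs (al ++ e) (be ++ f) q w n =
  qpochs al q n / qpochs (q :: be) q n * bhs_tail e f w n.
Proof.
move=> sz_al; rewrite /bhs /bhs_tail -cat_cons !qpochs_cat !size_cat sz_al.
have -> : 1 + (size be + size f)%:Z - ((size be).+1 + size e)%:Z =
          (size f)%:Z - (size e)%:Z :> int.
  by rewrite -addn1 !PoszD; ring.
by rewrite -mulf_div !mulrA.
Qed.

(* The argument q^(s-r) z of the second series makes the powers of q symmetric:
   C(j,2) + j = C(j+1,2). *)
Lemma bhs_tail_sym e f i j :
  let t := bhs_tail e f 1 in
  let t' := bhs_tail [seq p * q | p <- e] [seq p * q | p <- f]
              (q ^ ((size f)%:Z - (size e)%:Z)) in
  t i.+1 * t' j = t j.+1 * t' i.
Proof.
move=> /=; rewrite /bhs_tail !size_map !expr1n !mulr1 !qpochsS.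
move: (_ - _) => m.
have pw (k : nat) : (q ^ m) ^+ k = (q ^+ k) ^ m := exprzAC q m k.
rewrite !pw.
have sg k : ((-1) ^+ k * q ^+ 'C(k, 2)) ^ m * (q ^+ k) ^ m =
    ((-1) ^+ k) ^ m * (q ^+ 'C(k.+1, 2)) ^ m.
  by rewrite -!expfzMl -mulrA -exprD binS bin1.
rewrite -![_ * (_ * _) ^ m * (q ^+ _) ^ m]mulrA !sg !expfzMl !exprS !expfzMl.
rewrite !invfM; ring.
Qed.

End QPochhammer.

(** * Flat pairs (p)_(i+1) (p)_j and spread pairs (p/q)_(i+1) (pq)_j *)

Section TwoIndexProducts.
Variables (K : fieldType) (q : K).
Hypothesis q_neq0 : q != 0.
Implicit Types (p : K) (i j n : nat).

(** The numerator parameters u = bc/a, c and d occur in each product as a flat or a spread pair;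
    both kinds reduce to the symmetric (p)_i (p)_j times factors linear in q^i or q^j, the spread
    one at the cost of a factor 1 - p. *)
Lemma qpoch_flat p i j : qpoch p q i.+1 * qpoch p q j =
  qpoch p q i * qpoch p q j * (1 - p * q ^+ i).
Proof. by rewrite qpochSr mulrAC. Qed.

Lemma qpoch_spread p i j :
  (1 - p) * (qpoch (p / q) q i.+1 * qpoch (p * q) q j) =
  qpoch p q i * qpoch p q j * ((1 - p / q) * (1 - p * q ^+ j)).
Proof.
rewrite qpochS_div // mulrCA qpoch_shift; ring.
Qed.

Lemma qpoch_nz_factor p n : qpoch_nz q p -> 1 - p * q ^+ n != 0.
Proof. by move=> /(_ n.+1); rewrite qpochSr mulf_eq0 => /norP[]. Qed.

Lemma qpoch_nz1 p : qpoch_nz q p -> 1 - p != 0.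
Proof. by move=> /qpoch_nz_factor -/(_ 0%N); rewrite expr0 mulr1. Qed.

(** Symmetric core of a denominator pair, normalised so that the flat and the spread reciprocals are
    both [den] times a polynomial in q^i and q^j. *)
Definition den p i j : K :=
  (1 - p) / ((1 - p / q) * qpoch p q i.+1 * qpoch p q j.+1).

Lemma den_sym p i j : den p i j = den p j i.
Proof. by rewrite /den mulrAC. Qed.

Lemma den_flat p i j : qpoch_nz q p -> 1 - p / q != 0 ->
  (1 - p) / (qpoch p q i.+1 * qpoch p q j) =
  den p i j * ((1 - p / q) * (1 - p * q ^+ j)).
Proof.
move=> p0; rewrite /den (qpochSr _ _ j); move: (1 - p / q) => t t0.
by field; rewrite t0 !p0 qpoch_nz_factor.
Qed.

Lemma den_spread p i j : qpoch_nz q p -> qpoch_nz q (p * q) -> 1 - p / q != 0 ->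
  (qpoch (p / q) q i.+1 * qpoch (p * q) q j)^-1 =
  den p i j * (1 - p * q ^+ i).
Proof.
move=> p0 pq0; rewrite /den qpochS_div // (qpochSr _ _ i) (qpochS _ _ j).
move: (1 - p / q) => t t0.
by field; rewrite t0 qpoch_nz1 // p0 pq0 qpoch_nz_factor.
Qed.

End TwoIndexProducts.

(** * The summand built from a, b, c, d, and its antisymmetry *)

Section Terms.
Variables (K : fieldType) (q a b c d : K).
Hypotheses (q_neq0 : q != 0) (a_neq0 : a != 0) (d_neq0 : d != 0).
Implicit Types (p : K) (x y : K) (i j : nat).

Let u := a^-1 * b * c.
Let v := b * c / d.

(** Since a u = d v = bc, the constant and the y^2 coefficients vanish by the same identity in a, b,
    c, d. *)
Lemma initial_identity y :
  - d * (a - b) * (a - c) * (1 - v * y) * (1 - d * y)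
  - (a - d) * (b * c - a * d) * (1 - b * y) * (1 - c * y)
  + a * (b - d) * (c - d) * (1 - a * y) * (1 - u * y) = 0.
Proof. by rewrite /u /v; field; rewrite a_neq0 d_neq0. Qed.

(** With x = q^i and y = q^j, the left side collects the linear factors that flat and spread pairs
    leave in [term i.+1 j]. *)
Lemma paired_identity x y :
  - d * (a - b) * (a - c) * (1 - b * x) * (1 - a * x)
    * ((1 - v / q) * (1 - v * y)) * (1 - u * x) * (1 - c * x)
    * ((1 - d / q) * (1 - d * y))
  - (a - d) * (b * c - a * d) * (1 - a * x) * ((1 - b / q) * (1 - b * y))
    * (1 - v * x) * (1 - u * x) * ((1 - c / q) * (1 - c * y)) * (1 - d * x)
  + a * (b - d) * (c - d) * ((1 - a / q) * (1 - a * y)) * (1 - b * x)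
    * (1 - v * x) * ((1 - u / q) * (1 - u * y)) * (1 - c * x) * (1 - d * x)
  = (a - b) * (a - c) * (a - d) * (b - d) * (c - d) * (b * c - a * d)
    / (a * d * q) * (1 - b * c * x * y) * (x - y)
    * (1 - b * c / q * x) * (1 - q * x).
Proof. by rewrite /u /v; field; rewrite a_neq0 d_neq0 q_neq0. Qed.

Definition ratio al be n : K := qpochs al q n / qpochs (q :: be) q n.

(** Pairs the factors by parameter; the second numerator pair is put over the pair of q because this
    quotient is the same in all three products. *)
Lemma ratio_mul p1 p2 p3 p4 r1 r2 r3 p1' p2' p3' p4' r1' r2' r3' i j :
  ratio [:: p1; p2; p3; p4] [:: r1; r2; r3] i
  * ratio [:: p1'; p2'; p3'; p4'] [:: r1'; r2'; r3'] j =
  (qpoch p1 q i * qpoch p1' q j)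
  * ((qpoch p2 q i * qpoch p2' q j) / (qpoch q q i * qpoch q q j))
  * (qpoch p3 q i * qpoch p3' q j) * (qpoch p4 q i * qpoch p4' q j)
  * (qpoch r1 q i * qpoch r1' q j)^-1 * (qpoch r2 q i * qpoch r2' q j)^-1
  * (qpoch r3 q i * qpoch r3' q j)^-1.
Proof. by rewrite /ratio !qpochs_cons !qpochs_nil !mulr1 !invfM; ring. Qed.

(** Left side minus right side of the theorem at coefficients i and j, without the common factor due
    to [e], [f] and the argument. *)
Definition term i j : K :=
  (a - b) * (a - c) * (b * c - d) * (1 - d) *
    (ratio [:: u; b * c / q ^+ 2; c; d / q] [:: a / q; b / q; v] i
     * ratio [:: u; b * c; c; d * q] [:: a * q; b * q; v] j)
  - (a - d) * (1 - b) * (1 - c) * (b * c - a * d) *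
    (ratio [:: u; b * c / q ^+ 2; c / q; d] [:: a / q; b; v / q] i
     * ratio [:: u; b * c; c * q; d] [:: a * q; b; v * q] j)
  + (1 - a) * (b - d) * (c - d) * (a - b * c) *
    (ratio [:: u / q; b * c / q ^+ 2; c; d] [:: a; b / q; v / q] i
     * ratio [:: u * q; b * c; c; d] [:: a; b * q; v * q] j).

Hypotheses (a0 : qpoch_nz q a) (aq0 : qpoch_nz q (a * q)) (a1 : 1 - a / q != 0).
Hypotheses (b0 : qpoch_nz q b) (bq0 : qpoch_nz q (b * q)) (b1 : 1 - b / q != 0).
Hypotheses (v0 : qpoch_nz q v) (vq0 : qpoch_nz q (v * q)) (v1 : 1 - v / q != 0).
Hypothesis q0 : qpoch_nz q q.

(** The prefactors of the theorem supply the 1 - p required by each flat denominator and each spread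
    numerator; bc - d and a - bc do so for v and u. *)
Let bc_dE : b * c - d = - d * (1 - v).
Proof. by rewrite /v; field. Qed.

Let a_bcE : a - b * c = a * (1 - u).
Proof. by rewrite /u; field. Qed.

Lemma term0 j : term 0 j = 0.
Proof.
rewrite /term !ratio_mul !qpoch0 !mul1r bc_dE a_bcE.
set W := qpoch (b * c) q j / qpoch q q j.
have shift_inv p : qpoch_nz q p -> qpoch_nz q (p * q) ->
    (qpoch (p * q) q j)^-1 = (1 - p) / qpoch p q j.+1.
  by move=> p0 pq0; rewrite qpochS invfM mulVKf // (qpoch_nz1 p0).
have inv_flat p : qpoch_nz q p ->
    (qpoch p q j)^-1 = (1 - p * q ^+ j) / qpoch p q j.+1.
  by move=> p0; rewrite qpochSr invfM mulrCA divff ?mulr1 // qpoch_nz_factor.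
rewrite !shift_inv // !inv_flat //.
set y := q ^+ j.
transitivity ((1 - a) * (1 - b) * (1 - v) * W * qpoch u q j * qpoch c q j
  * qpoch d q j / qpoch a q j.+1 / qpoch b q j.+1 / qpoch v q j.+1 * (
  - d * (a - b) * (a - c) * (1 - v * y) * (1 - d * y)
  - (a - d) * (b * c - a * d) * (1 - b * y) * (1 - c * y)
  + a * (b - d) * (c - d) * (1 - a * y) * (1 - u * y))); last first.
  by rewrite initial_identity mulr0.
have := (qpoch_shift q c j, qpoch_shift q d j, qpoch_shift q u j).
(* With each 1 - p an atom, the left sides become monomials, which [ring] can use as rewrite
   rules. *)
rewrite -/y; move: (1 - c) (1 - d) (1 - u) => c1 d1 u1 [[shc shd] shu].
ring: shc shd shu.
Qed.

(* [(bc q^-2)_(i+1) (bc)_j / ((q)_(i+1) (q)_j)] is not symmetric in i and j; the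
   factors [1 - bc q^(i-1)] and [1 - q^(i+1)] of [paired_identity] complete it
   to a symmetric expression. *)
Lemma termS i j : term i.+1 j =
  (a - b) * (a - c) * (a - d) * (b - d) * (c - d) * (b * c - a * d)
  / (a * d * q) * (1 - b * c / q ^+ 2) * (1 - b * c / q)
  * den q a i j * den q b i j * den q v i j
  * (qpoch u q i * qpoch u q j) * (qpoch c q i * qpoch c q j)
  * (qpoch d q i * qpoch d q j) * (qpoch (b * c) q i * qpoch (b * c) q j)
  / (qpoch q q i * qpoch q q j)
  * (1 - b * c * q ^+ i * q ^+ j) * (q ^+ i - q ^+ j).
Proof.
rewrite /term !ratio_mul bc_dE a_bcE.
set W := qpoch (b * c / _) _ _ * _ / _.
(* The two factors extend (bc/q^2)_(i+1) to (bc/q^2)_(i+2) = (1 - bc/q^2) (1 - bc/q) (bc)_i and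
   reduce (q)_(i+1) to (q)_i. *)
have WE : W * (1 - b * c / q * q ^+ i) * (1 - q * q ^+ i) =
    (1 - b * c / q ^+ 2) * (1 - b * c / q)
    * (qpoch (b * c) q i * qpoch (b * c) q j) / (qpoch q q i * qpoch q q j).
  have bcE : b * c / q ^+ 2 = b * c / q / q by rewrite expr2 invfM mulrA.
  have := qpochSr q (b * c / q) i; rewrite qpochS_div // => sh.
  rewrite /W bcE qpochS_div // qpochSr invfM invfM.
  have := q0 i.+1; rewrite qpochSr mulf_eq0 => /norP[Q0 Q1].
  transitivity ((1 - b * c / q / q) * (qpoch (b * c / q) q i
     * (1 - b * c / q * q ^+ i)) * qpoch (b * c) q j
     / (qpoch q q i * qpoch q q j)).
    by field; rewrite q_neq0 Q0 Q1 !q0.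
  by rewrite -sh invfM; ring.
rewrite !(den_spread q_neq0) //.
rewrite (qpoch_flat q u) (qpoch_flat q c) (qpoch_flat q d).
set x := q ^+ i; set y := q ^+ j.
transitivity (W * den q a i j * den q b i j * den q v i j
  * (qpoch u q i * qpoch u q j) * (qpoch c q i * qpoch c q j)
  * (qpoch d q i * qpoch d q j) * (
  - d * (a - b) * (a - c) * (1 - b * x) * (1 - a * x)
    * ((1 - v / q) * (1 - v * y)) * (1 - u * x) * (1 - c * x)
    * ((1 - d / q) * (1 - d * y))
  - (a - d) * (b * c - a * d) * (1 - a * x) * ((1 - b / q) * (1 - b * y))
    * (1 - v * x) * (1 - u * x) * ((1 - c / q) * (1 - c * y)) * (1 - d * x)
  + a * (b - d) * (c - d) * ((1 - a / q) * (1 - a * y)) * (1 - b * x)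
    * (1 - v * x) * ((1 - u / q) * (1 - u * y)) * (1 - c * x) * (1 - d * x))).
  have := (qpoch_spread q_neq0 c i j, qpoch_spread q_neq0 d i j,
           qpoch_spread q_neq0 u i j).
  have := (den_flat i j a0 a1, den_flat i j b0 b1, den_flat i j v0 v1).
  rewrite -/x -/y.
  move: (1 - a) (1 - b) (1 - v) (1 - c) (1 - d) (1 - u).
  move=> aa bb vv cc dd uu [[ha hb] hv] [[hc hd] hu].
  ring: ha hb hv hc hd hu.
rewrite paired_identity.
transitivity ((a - b) * (a - c) * (a - d) * (b - d) * (c - d) * (b * c - a * d)
  / (a * d * q) * (W * (1 - b * c / q * x) * (1 - q * x))
  * den q a i j * den q b i j * den q v i j
  * (qpoch u q i * qpoch u q j) * (qpoch c q i * qpoch c q j)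
  * (qpoch d q i * qpoch d q j) * (1 - b * c * x * y) * (x - y)).
  ring.
rewrite WE; ring.
Qed.

(** In [termS] every factor is symmetric in i and j except the last, q^i - q^j. *)
Lemma termS_antisym i j : term i.+1 j = - term j.+1 i.
Proof.
rewrite !termS (den_sym q a) (den_sym q b) (den_sym q v) !invfM.
ring.
Qed.

End Terms.

(** * Comparison of the coefficients of z^n *)

Local Open Scope complex_scope.

Theorem theorem1p1 (R : realType) (q0 : R) (hq : 0 < q0 < 1) (r s : nat)
  (a b c d : R[i]) (e : r.-tuple R[i]) (f : s.-tuple R[i]) :
  let q : R[i] := q0%:C in
  let e_q := [seq x * q | x <- e] in
  let f_q := [seq x * q | x <- f] in
  let w := q ^ (s%:Z - r%:Z) in
  a != 0 -> d != 0 ->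
  bhs_defined ([:: a / q; b / q; b * c / d] ++ f) q ->
  bhs_defined ([:: a * q; b * q; b * c / d] ++ f_q) q ->
  bhs_defined ([:: a / q; b; b * c / d / q] ++ f) q ->
  bhs_defined ([:: a * q; b; b * c / d * q] ++ f_q) q ->
  bhs_defined ([:: a; b / q; b * c / d / q] ++ f) q ->
  bhs_defined ([:: a; b * q; b * c / d * q] ++ f_q) q ->
  forall n : nat,
    (a - b) * (a - c) * (b * c - d) * (1 - d) *
    fps_mul
      (bhs ([:: a^-1 * b * c; b * c / q ^+ 2; c; d / q] ++ e)
           ([:: a / q; b / q; b * c / d] ++ f) q 1)
      (bhs ([:: a^-1 * b * c; b * c; c; d * q] ++ e_q)
           ([:: a * q; b * q; b * c / d] ++ f_q) q w) n
    =
    (a - d) * (1 - b) * (1 - c) * (b * c - a * d) *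
    fps_mul
      (bhs ([:: a^-1 * b * c; b * c / q ^+ 2; c / q; d] ++ e)
           ([:: a / q; b; b * c / d / q] ++ f) q 1)
      (bhs ([:: a^-1 * b * c; b * c; c * q; d] ++ e_q)
           ([:: a * q; b; b * c / d * q] ++ f_q) q w) n
    -
    (1 - a) * (b - d) * (c - d) * (a - b * c) *
    fps_mul
      (bhs ([:: a^-1 * b * c / q; b * c / q ^+ 2; c; d] ++ e)
           ([:: a; b / q; b * c / d / q] ++ f) q 1)
      (bhs ([:: a^-1 * b * c * q; b * c; c; d] ++ e_q)
           ([:: a; b * q; b * c / d * q] ++ f_q) q w) n.
Proof.
move=> q e_q f_q w a_neq0 d_neq0 h1 h2 h3 h4 h5 h6 n.
have q_neq0 : q != 0.
  by case/andP: hq => q0_gt0 _; rewrite /q (inj_eq (@complexI R)) gt_eqF.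
set u := a^-1 * b * c; set v := b * c / d in h1 h2 h3 h4 h5 h6 *.
have q_nz : qpoch_nz q q by apply: bhs_defined_nz h1 _; rewrite !inE eqxx ?orbT.
have a_nz : qpoch_nz q a by apply: bhs_defined_nz h5 _; rewrite !inE eqxx ?orbT.
have b_nz : qpoch_nz q b by apply: bhs_defined_nz h3 _; rewrite !inE eqxx ?orbT.
have v_nz : qpoch_nz q v by apply: bhs_defined_nz h1 _; rewrite !inE eqxx ?orbT.
have aq_nz : qpoch_nz q (a * q).
  by apply: bhs_defined_nz h2 _; rewrite !inE eqxx ?orbT.
have bq_nz : qpoch_nz q (b * q).
  by apply: bhs_defined_nz h2 _; rewrite !inE eqxx ?orbT.
have vq_nz : qpoch_nz q (v * q).
  by apply: bhs_defined_nz h4 _; rewrite !inE eqxx ?orbT.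
(* The factor 1 - p/q is (p/q)_1, nonzero because p/q is a lower parameter of one of the series. *)
have a_q : 1 - a / q != 0.
  by apply: qpoch_nz1 (bhs_defined_nz h1 _); rewrite !inE eqxx ?orbT.
have b_q : 1 - b / q != 0.
  by apply: qpoch_nz1 (bhs_defined_nz h1 _); rewrite !inE eqxx ?orbT.
have v_q : 1 - v / q != 0.
  by apply: qpoch_nz1 (bhs_defined_nz h3 _); rewrite !inE eqxx ?orbT.
have wE : w = q ^ ((size f)%:Z - (size e)%:Z) by rewrite !size_tuple.
pose t := bhs_tail q e f 1; pose t' := bhs_tail q e_q f_q w.
have tail_sym i j : t i.+1 * t' j = t j.+1 * t' i.
  by rewrite /t /t' wE; apply: bhs_tail_sym.
have mulE al be al' be' : size al = (size be).+1 -> size al' = (size be').+1 ->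
    fps_mul (bhs (al ++ e) (be ++ f) q 1)
            (bhs (al' ++ e_q) (be' ++ f_q) q w) n =
    \sum_(i < n.+1) ratio q al be i * ratio q al' be' (n - i)%N
                    * (t i * t' (n - i)%N).
  move=> sz sz'; apply: eq_bigr => i _.
  by rewrite (bhs_cat q e f 1 i sz) (bhs_cat q e_q f_q w _ sz') mulrACA.
rewrite !mulE //; apply/eqP; rewrite -subr_eq0 opprB addrA addrAC; apply/eqP.
rewrite !mulr_sumr -sumrB -big_split /=.
transitivity (\sum_(i < n.+1)
  term q a b c d i (n - i)%N * (t i * t' (n - i)%N)).
  by apply: eq_bigr => i _; rewrite /term -/u -/v; ring.
rewrite big_ord_recl subn0 term0 // mul0r add0r.
case: n {mulE} => [|m]; first by rewrite big_ord0.
(* Here n = m+1 and the index is lowered by one, so the pairing i <-> n+1-i becomes the reversal i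
   <-> m-i. *)
pose G i j := term q a b c d i.+1 j * (t i.+1 * t' j).
rewrite -[RHS](sum_antisym (G := G) m) //.
by move=> i j; rewrite /G tail_sym termS_antisym // mulNr.
Qed.
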